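(* Let $H$ be a complex Hilbert space with $\dim H\ge 2$ and let $T\in B(H)$, $T\neq 0$. Then $$\hat{\varepsilon}(T)=\frac{\|T\|^{2}-m(T)^{2}}{\|T\|^{2}+m(T)^{2}}\qquad\text{and}\qquad m(T)=\sqrt{\frac{1-\hat{\varepsilon}(T)}{1+\hat{\varepsilon}(T)}}\;\|T\|.$$
   Context: $B(H)$ is the set of bounded linear operators on $H$, with operator norm $\|\cdot\|$. For $\varepsilon\in[0,1]$, an operator $T\in B(H)$ is called $\varepsilon$-AOP (approximately orthogonality-preserving) if for all $x,y\in H$ with $\langle x,y\rangle=0$ one has $|\langle Tx,Ty\rangle|\le\varepsilon\|Tx\|\,\|Ty\|$ (so every operator is $1$-AOP). Define $\hat{\varepsilon}(T)=\inf\{\varepsilon\in[0,1]: T\text{ is }\varepsilon\text{-AOP}\}$. The minimum modulus is $m(T)=\inf\{\|Tx\|: x\in H,\ \|x\|=1\}$, i.e. the largest $m\ge 0$ with $\|Tx\|\ge m\|x\|$ for all $x\in H$. *)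

(* Defs.v *)
From HB Require Import structures.
From mathcomp Require Import all_boot all_order all_algebra.
From mathcomp Require Import complex.
From mathcomp Require Import all_classical all_reals all_analysis.

Set Implicit Arguments.
Unset Strict Implicit.
Unset Printing Implicit Defensive.

Import Order.TTheory GRing.Theory Num.Theory Num.Def.
Import numFieldNormedType.Exports.

Local Open Scope classical_set_scope.
Local Open Scope ring_scope.
Local Open Scope complex_scope.

(* A complex Hilbert space is a complete normed space over R[i] together with a
   positive definite Hermitian form inducing its norm.  In MathComp, such a
   form is linear in its first argument and conjugate-linear in the second. *)
Definition induces_norm (R : realType) (H : completeNormedModType R[i])
    (dot : {dot H for (@conjC R[i])}) : Prop :=
  forall x : H, `|x| ^+ 2 = dot x x.

Definition dim_ge2 (K : fieldType) (V : lmodType K) : Prop :=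
  exists u v : V, forall a b : K, a *: u + b *: v = 0 -> a = 0 /\ b = 0.

(* The library norm on an R[i]-module takes values in R[i]; it is a real
   number there, so that taking the real part loses nothing (normRE). *)
Definition normR (R : realType) (V : normedModType R[i]) (x : V) : R :=
  complex.Re `|x|.

Lemma normRE (R : realType) (V : normedModType R[i]) (x : V) :
  (normR x)%:C = `|x|.
Proof. by rewrite /normR RRe_real// normr_real. Qed.

Section operators.
Context {R : realType} {H : completeNormedModType R[i]}.
Implicit Types T : H -> H.

Definition bounded_op T : Prop :=
  exists M : R, forall x, `|T x| <= M%:C * `|x|.

Definition op_norm T : R :=
  sup [set normR (T x) | x in [set x : H | normR x <= 1]].

Definition min_modulus T : R :=
  inf [set normR (T x) | x in [set x : H | normR x = 1]].

Variable dot : {dot H for (@conjC R[i])}.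

Definition AOP (e : R) T : Prop :=
  forall x y : H, dot x y = 0 ->
    `|dot (T x) (T y)| <= e%:C * `|T x| * `|T y|.

Definition eps_hat T : R :=
  inf [set e : R | 0 <= e <= 1 /\ AOP e T].

End operators.

(* Main.v *)
(* Write [M] for the norm and [m] for the minimum modulus of [T].  The operator
   is [(M^2 - m^2)/(M^2 + m^2)]-AOP by Wielandt's argument.  Conversely, if
   [|u| = |v|] and the phase of [u] is chosen so that [<u, v>] is real, then
   [u + v] and [u - v] are orthogonal, and the AOP inequality for this pair
   gives [|Tu|^2 - |Tv|^2 <= e (|Tu|^2 + |Tv|^2)]; letting [|Tu|] tend to [M]
   and [|Tv|] to [m] on the unit sphere yields the lower bound on [e]. *)
Require Import Defs.
From mathcomp Require Import all_boot all_order all_algebra.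
From mathcomp Require Import complex.
From mathcomp Require Import all_classical all_reals all_analysis.
From mathcomp Require Import ring lra.
Import Order.TTheory GRing.Theory Num.Theory Num.Def.
Import numFieldNormedType.Exports.
Local Open Scope ring_scope.
Local Open Scope complex_scope.

(** * Real-valued norms on complex modules *)

Lemma Re_normK (R : realType) (z : R[i]) : (complex.Re `|z|)%:C = `|z|.
Proof. by rewrite RRe_real ?normr_real. Qed.

Lemma real_complexM (R : realType) (a b : R) : (a * b)%:C = a%:C * b%:C.
Proof. exact: rmorphM. Qed.

Section normR.
Context {R : realType} {V : normedModType R[i]}.
Implicit Types x y : V.

Lemma normR_ge0 x : 0 <= normR x.
Proof. by rewrite -ler0c normRE. Qed.

Lemma normRZ (a : R[i]) x : normR (a *: x) = complex.Re `|a| * normR x.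
Proof.
apply: complexI; by rewrite real_complexM !normRE normrZ Re_normK.
Qed.

Lemma normRZr (a : R) x : normR (a%:C *: x) = `|a| * normR x.
Proof. by rewrite normRZ normc_def/= expr0n addr0 sqrtr_sqr. Qed.

Lemma normRZ_unimodular (a : R[i]) x : `|a| = 1 -> normR (a *: x) = normR x.
Proof. by move=> a1; rewrite normRZ a1 mul1r. Qed.

Lemma normR_eq0 x : (normR x == 0) = (x == 0).
Proof. by rewrite -(inj_eq (@complexI R)) normRE normr_eq0. Qed.

Lemma normR0 : normR (0 : V) = 0.
Proof. by apply/eqP; rewrite normR_eq0. Qed.

Lemma normR_normalize x : x != 0 -> normR ((normR x)^-1%:C *: x) = 1.
Proof.
move=> x0; rewrite normRZr ger0_norm ?invr_ge0 ?normR_ge0// mulVf//.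
by rewrite normR_eq0.
Qed.

End normR.

(** Supplies the phase factor that turns an inner product into its modulus. *)
Lemma unimodular_rotation {R : realType} (c : R[i]) :
  exists w : R[i], `|w| = 1 /\ w * c = `|c|.
Proof.
have [->|c0] := eqVneq c 0; first by exists 1; rewrite normr1 normr0 mulr0.
exists (`|c| / c); split; last by rewrite divfK.
by rewrite normrM normrV ?unitfE// normr_id divff ?normr_eq0.
Qed.

(** * Polarization identities for the inner product *)

Section hermitian.
Context {R : realType} {H : completeNormedModType R[i]}.
Variable dot : {dot H for (@conjC R[i])}.
Hypothesis hilbertH : induces_norm dot.
Implicit Types x y : H.

Lemma dotC x y : dot x y = (dot y x)^*%R.
Proof. by rewrite (hermC dot) expr0 mul1r. Qed.

Lemma dot_normR x : dot x x = (normR x ^+ 2)%:C.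
Proof. by rewrite -hilbertH rmorphXn /= normRE. Qed.

Lemma normRD_sqr x y :
  normR (x + y) ^+ 2 = normR x ^+ 2 + normR y ^+ 2 + 2 * complex.Re (dot x y).
Proof.
have := hnormD dot x y; rewrite /= !dot_normR expr0 mul1r.
move/(congr1 (@complex.Re R)); case: (dot x y) => a b /= ->; ring.
Qed.

Lemma normRB_sqr x y :
  normR (x - y) ^+ 2 = normR x ^+ 2 + normR y ^+ 2 - 2 * complex.Re (dot x y).
Proof.
rewrite normRD_sqr linearNr /= /normR normrN; case: (dot x y) => a b /=; ring.
Qed.

Lemma dot_scale (a b : R[i]) x y : dot (a *: x) (b *: y) = a * b^*%R * dot x y.
Proof. by rewrite linearZl_LR linearZr_LR /= mulrA. Qed.

(** The cross terms [<y, x> - <x, y>] form a purely imaginary number. *)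
Lemma Re_dotDB x y :
  complex.Re (dot (x + y) (x - y)) = normR x ^+ 2 - normR y ^+ 2.
Proof.
rewrite linearDl !linearBr /= !dot_normR (dotC y x).
by case: (dot x y) => a b /=; ring.
Qed.

(** The cross terms cancel because [<y, x>] is the conjugate of the real number [<x, y>]. *)
Lemma dotDB_eq0 x y : normR x = normR y -> dot x y \is Num.real ->
  dot (x + y) (x - y) = 0.
Proof.
move=> nxy rxy; rewrite linearDl !linearBr /= !dot_normR nxy.
rewrite (dotC y x) (conj_Creal rxy); ring.
Qed.

End hermitian.

(** * Two-sided bounds on [|T x|] by the norm and the minimum modulus *)

Section operators.
Context {R : realType} {H : completeNormedModType R[i]}.
Variable T : {linear H -> H}.
Hypothesis bT : bounded_op T.

Lemma op_normP x : normR (T x) <= op_norm T * normR x.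
Proof.
have [->|x0] := eqVneq x 0; first by rewrite raddf0 normR0 mulr0.
have nx : 0 < normR x by rewrite lt_def normR_eq0 x0 normR_ge0.
rewrite -ler_pdivrMr// mulrC -[_^-1]ger0_norm ?invr_ge0 ?normR_ge0//.
rewrite -normRZr -linearZ; apply: ub_le_sup; last first.
  by exists ((normR x)^-1%:C *: x) => //=; rewrite normR_normalize.
(* The sign of [M] is not given; the absolute value bounds [|T y|] on the whole unit ball. *)
case: bT => M TM; exists `|M| => _ [y /= y1 <-].
have : normR (T y) <= M * normR y.
  by rewrite -lecR normRE (le_trans (TM y))// -normRE -rmorphM.
have := ler_norm M; have := normR_ge0 y; have := normr_ge0 M; nra.
Qed.

Lemma min_modulusP x : min_modulus T * normR x <= normR (T x).
Proof.
have [->|x0] := eqVneq x 0; first by rewrite raddf0 normR0 mulr0.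
have nx : 0 < normR x by rewrite lt_def normR_eq0 x0 normR_ge0.
rewrite -ler_pdivlMr// [leRHS]mulrC -[_^-1]ger0_norm ?invr_ge0 ?normR_ge0//.
rewrite -normRZr -linearZ; apply: ge_inf.
  by exists 0 => _ [y _ <-]; exact: normR_ge0.
by exists ((normR x)^-1%:C *: x) => //=; rewrite normR_normalize.
Qed.

Lemma min_modulus_ge0 : 0 <= min_modulus T.
Proof.
have [E0|E0] := pselect ([set normR (T x) | x in [set x : H | normR x = 1]] !=set0)%classic.
  by apply: lb_le_inf => // _ [y _ <-]; exact: normR_ge0.
(* If the unit sphere is empty, the infimum takes its default value 0. *)
by rewrite /min_modulus inf_out// => -[].
Qed.

Lemma op_norm_gt0 : T <> \0 :> (H -> H) -> 0 < op_norm T.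
Proof.
move=> T0; rewrite ltNge; apply/negP => M0; apply: T0; apply/funext => x /=.
apply/eqP; rewrite -normR_eq0 eq_le normR_ge0 andbT.
by rewrite (le_trans (op_normP x))// mulr_le0_ge0 ?normR_ge0.
Qed.

(** * Approximate orthogonality preservation against the two bounds *)

Variable dot : {dot H for (@conjC R[i])}.
Hypothesis hilbertH : induces_norm dot.

(* Rescale [x] and [y] so that [T x] and [T y] have the same length and a
   nonnegative product: then [x + y] and [x - y] have equal norms by
   orthogonality, while [|T (x + y)|^2 / |T (x - y)|^2 = (p + q) / (p - q)] with
   [p = |T x| |T y|] and [q = |<T x, T y>|], a ratio bounded by [M^2 / m^2]. *)
Lemma wielandt (m M : R) x y : 0 <= m -> 0 < M ->
  (forall z, m * normR z <= normR (T z)) ->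
  (forall z, normR (T z) <= M * normR z) -> dot x y = 0 ->
  complex.Re `|dot (T x) (T y)| * (M ^+ 2 + m ^+ 2) <=
  (M ^+ 2 - m ^+ 2) * (normR (T x) * normR (T y)).
Proof.
move=> m0 M0 Tm TM xy0; set c := dot (T x) (T y).
have [Tx0|Tx0] := eqVneq (T x) 0.
  by rewrite /c Tx0 linear0l normr0 normR0 !(mul0r, mulr0).
have [Ty0|Ty0] := eqVneq (T y) 0.
  by rewrite /c Ty0 linear0r normr0 normR0 !(mul0r, mulr0).
have [w [w1 wc]] := unimodular_rotation c.
set a := normR (T x); set b := normR (T y); set q := complex.Re `|c|.
have a0 : 0 < a by rewrite lt_def normR_eq0 Tx0 normR_ge0.
have b0 : 0 < b by rewrite lt_def normR_eq0 Ty0 normR_ge0.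
pose u := (b%:C * w) *: x; pose v := a%:C *: y.
have uv0 : dot u v = 0 by rewrite dot_scale xy0 mulr0.
have Tu : normR (T u) = a * b.
  rewrite linearZ /= -scalerA normRZr (normRZ_unimodular _ _ w1).
  by rewrite ger0_norm ?normR_ge0// mulrC.
have Tv : normR (T v) = a * b by rewrite linearZ /= normRZr ger0_norm ?normR_ge0.
have Tuv : complex.Re (dot (T u) (T v)) = a * b * q.
  rewrite [T u]linearZ [T v]linearZ /= dot_scale -/c.
  have -> : b%:C * w * (a%:C)^*%R * c = (a * b)%:C * `|c|.
    have -> : (a%:C)^*%R = a%:C by exact: conjc_real.
    by rewrite -wc real_complexM; ring.
  by rewrite -Re_normK -real_complexM.
have sqle (s t : R) : 0 <= s -> s <= t -> s ^+ 2 <= t ^+ 2.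
  by move=> s0 st; rewrite lerXn2r ?nnegrE// (le_trans s0).
have uM := sqle _ _ (normR_ge0 _) (TM (u + v)).
have vm := sqle _ _ (mulr_ge0 m0 (normR_ge0 _)) (Tm (u - v)).
rewrite linearD exprMn !(normRD_sqr dot hilbertH) Tuv Tu Tv uv0 /= mulr0 addr0 in uM.
rewrite linearB exprMn !(normRB_sqr dot hilbertH) Tuv Tu Tv uv0 /= mulr0 subr0 in vm.
have p0 : 0 < a * b by rewrite mulr_gt0.
set p := a * b in p0 uM vm *; set n := normR u ^+ 2 + _ in uM vm.
(* Here [n] is the common value of [|u + v|^2] and [|u - v|^2], and both sides are compared with
   [m^2 M^2 n / 2]. The product form avoids dividing by [m] or [p - q], which may vanish. *)
have : m ^+ 2 * (p + q) * p <= M ^+ 2 * (p - q) * p.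
  have := ler_wpM2l (sqr_ge0 m) uM; have := ler_wpM2l (sqr_ge0 M) vm; lra.
by rewrite ler_pM2r//; lra.
Qed.

Lemma AOP_wielandt (m M : R) : 0 <= m -> 0 < M ->
  (forall z, m * normR z <= normR (T z)) ->
  (forall z, normR (T z) <= M * normR z) ->
  AOP dot ((M ^+ 2 - m ^+ 2) / (M ^+ 2 + m ^+ 2)) T.
Proof.
move=> m0 M0 Tm TM x y /(wielandt m M x y m0 M0 Tm TM).
have d0 : 0 < M ^+ 2 + m ^+ 2 by rewrite ltr_wpDr ?sqr_ge0 ?exprn_gt0.
rewrite -ler_pdivlMr// -lecR Re_normK => /le_trans; apply.
by rewrite -!normRE -!real_complexM lecR mulrAC !mulrA.
Qed.

Lemma AOP_eq_norm (e : R) u v : 0 <= e -> AOP dot e T -> normR u = normR v ->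
  (1 - e) * normR (T u) ^+ 2 <= (1 + e) * normR (T v) ^+ 2.
Proof.
move=> e0 Te uv; have [w [w1 wc]] := unimodular_rotation (dot u v).
have nw z : normR (w *: z) = normR z := normRZ_unimodular w z w1.
(* Passing from [u] to [w *: u] preserves [|u|] and [|T u|] and makes the product with [v] real. *)
rewrite -[normR (T u)]nw -linearZ.
have {uv} : normR (w *: u) = normR v by rewrite nw.
have : dot (w *: u) v \is Num.real by rewrite linearZl_LR /= wc normr_real.
move: (w *: u) => {w1 wc nw}u ruv uv.
have := Te _ _ (dotDB_eq0 dot hilbertH _ _ uv ruv).
rewrite linearD linearB -!normRE -!real_complexM.
rewrite -[X in X <= _]Re_normK lecR -mulrA => Tuv.
have ReE := Re_dotDB dot hilbertH (T u) (T v).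
have sE := normRD_sqr dot hilbertH (T u) (T v).
have tE := normRB_sqr dot hilbertH (T u) (T v).
have Re_le : complex.Re (dot (T u + T v) (T u - T v)) <=
    complex.Re `|dot (T u + T v) (T u - T v)|.
  by rewrite -lecR Re_normK (le_trans _ (normc_ge_Re _))// lecR ler_norm.
(* With the parallelogram law, this square bounds [|Tu + Tv| |Tu - Tv|] by [|Tu|^2 + |Tv|^2]. *)
have st := sqr_ge0 (normR (T u + T v) - normR (T u - T v)).
have : e * (normR (T u + T v) * normR (T u - T v)) <=
       e * (normR (T u) ^+ 2 + normR (T v) ^+ 2).
  by rewrite ler_wpM2l//; lra.
lra.
Qed.

(** Square roots are taken in [AOP_eq_norm] first, so that the supremum over [u] and the infimum
    over [v] act on the norms themselves. *)
Lemma AOP_min_modulus (e : R) : 0 <= e <= 1 -> AOP dot e T ->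
  T <> \0 :> (H -> H) ->
  (1 - e) * op_norm T ^+ 2 <= (1 + e) * min_modulus T ^+ 2.
Proof.
move=> /andP[e0 e1] Te T0.
have [x x0] : exists x : H, x != 0.
  apply: contrapT => /forallNP x0; apply: T0; apply/funext => x.
  have /negP := x0 x; rewrite negbK => /eqP ->; exact: raddf0.
set s := Num.sqrt ((1 - e) / (1 + e)).
have s0 : 0 <= s by exact: sqrtr_ge0.
have d0 : 0 < 1 + e by lra.
have s2 : s ^+ 2 * (1 + e) = 1 - e.
  by rewrite sqr_sqrtr ?divr_ge0 ?subr_ge0 ?divfK ?gt_eqF// ltW.
(* [op_norm] ranges over the closed ball but [min_modulus] over the sphere, so [v] is first shrunk
   to the length of [u]. *)
have sT u v : normR u <= 1 -> normR v = 1 -> s * normR (T u) <= normR (T v).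
  move=> u1 v1; have := AOP_eq_norm e u ((normR u)%:C *: v) e0 Te.
  rewrite linearZ /= !normRZr v1 mulr1 ger0_norm ?normR_ge0//.
  move=> /(_ erefl); rewrite -s2 => suv.
  apply: (@le_trans _ _ (normR u * normR (T v))); last first.
    by rewrite ler_piMl ?normR_ge0.
  rewrite -ler_sqr ?nnegrE ?mulr_ge0 ?normR_ge0// -(ler_pM2l d0).
  by rewrite [leLHS]mulrC exprMn mulrAC.
have sM : s * op_norm T <= min_modulus T.
  apply: lb_le_inf.
    by exists (normR (T ((normR x)^-1%:C *: x))), ((normR x)^-1%:C *: x) => //=;
       rewrite normR_normalize.
  (* [s] vanishes exactly when [e = 1]; otherwise dividing by [s] leaves an upper bound to check for
     the supremum. *)
  move=> _ [v /= v1 <-]; have [->|sn0] := eqVneq s 0.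
    by rewrite mul0r normR_ge0.
  have sgt0 : 0 < s by rewrite lt_def sn0.
  rewrite -ler_pdivlMl//; apply: ge_sup.
    by exists (normR (T 0)), 0 => //=; rewrite normR0.
  by move=> _ [u /= u1 <-]; rewrite ler_pdivlMl// sT.
rewrite -s2 mulrAC -exprMn [leRHS]mulrC ler_pM2r//.
by rewrite ler_sqr ?nnegrE ?mulr_ge0 ?min_modulus_ge0// ltW// op_norm_gt0.
Qed.

End operators.

Theorem theorem2p3 (R : realType) (H : completeNormedModType R[i])
    (dot : {dot H for (@conjC R[i])}) (hilbertH : induces_norm dot)
    (dimH : dim_ge2 H) (T : {linear H -> H}) (bT : bounded_op T)
    (T0 : T <> \0 :> (H -> H)) :
  eps_hat dot T = (op_norm T ^+ 2 - min_modulus T ^+ 2) /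
                  (op_norm T ^+ 2 + min_modulus T ^+ 2) /\
  min_modulus T =
    Num.sqrt ((1 - eps_hat dot T) / (1 + eps_hat dot T)) * op_norm T.
Proof.
have M0 := op_norm_gt0 T bT T0; have m0 := min_modulus_ge0 T.
have TM := op_normP T bT; have Tm := min_modulusP T.
have AT := AOP_wielandt T dot hilbertH _ _ m0 M0 Tm TM.
have AM e e01 Te := AOP_min_modulus T bT dot hilbertH e e01 Te T0.
set M := op_norm T in M0 TM AT AM *; set m := min_modulus T in m0 Tm AT AM *.
have M2 : 0 < M ^+ 2 by rewrite exprn_gt0.
have m2 : 0 <= m ^+ 2 by rewrite sqr_ge0.
have d0 : 0 < M ^+ 2 + m ^+ 2 by rewrite ltr_wpDr.
(* Both bounds are compared at a vector with [T x] nonzero; then [x] is nonzero and [|x|]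
   cancels. *)
have mM : m <= M.
  have [x Tx] : exists x, 0 < normR (T x).
    apply: contrapT => /forallNP Tx; apply: T0; apply/funext => x /=.
    by apply/eqP; rewrite -normR_eq0 eq_le normR_ge0 andbT leNgt; apply/negP.
  have := le_trans (Tm x) (TM x); rewrite ler_pM2r// lt_def normR_ge0 andbT.
  by apply: contraTneq Tx => /eqP; rewrite normR_eq0 => /eqP ->; rewrite raddf0 normR0 ltxx.
have mM2 : m ^+ 2 <= M ^+ 2 by rewrite ler_sqr ?nnegrE// ltW.
have eE : eps_hat dot T = (M ^+ 2 - m ^+ 2) / (M ^+ 2 + m ^+ 2).
  have e0S : 0 <= (M ^+ 2 - m ^+ 2) / (M ^+ 2 + m ^+ 2) <= 1.
    rewrite ler_pdivrMr// mul1r lerD2l (le_trans _ m2) ?oppr_le0//.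
    by rewrite divr_ge0 ?subr_ge0// ltW.
  apply/eqP; rewrite eq_le; apply/andP; split.
    (* The candidate is itself admissible, so the infimum is attained there. *)
    by apply: ge_inf => //; exists 0 => e [/andP[]].
  apply: lb_le_inf; first by exists ((M ^+ 2 - m ^+ 2) / (M ^+ 2 + m ^+ 2)).
  by move=> e [e01 /(AM e e01)]; rewrite ler_pdivrMr//; lra.
split=> //; rewrite eE.
(* Numerator and denominator reduce to [2 m^2] and [2 M^2] over [M^2 + m^2]. *)
have -> : (1 - (M ^+ 2 - m ^+ 2) / (M ^+ 2 + m ^+ 2)) /
    (1 + (M ^+ 2 - m ^+ 2) / (M ^+ 2 + m ^+ 2)) = (m / M) ^+ 2.
  by field; rewrite ?gt_eqF//=; lra.
by rewrite sqrtr_sqr ger0_norm ?divfK ?gt_eqF// divr_ge0// ltW.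
Qed.
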